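(* Let $p$ be a parity for some class $B$ of free $n$-strand braids. Let $\beta$ be a braid-word representing a free braid for which $p$ is defined (i.e. a braid from $B$). If all classical crossings of $\beta$ are odd with respect to $p$ and no bigon reduction can be applied to the braid-word $\beta$, then every other braid-word $\beta'$ equivalent to $\beta$ in $\mathcal{FB}_n$ contains a subword which is strongly equivalent to $\beta$.
   Context: **Groups.** $\mathcal{F}_n$ is the group generated by $\zeta_1,\dots,\zeta_{n-1},\tau_1,\dots,\tau_{n-1}$ subject to the relations: (1) $\tau_i^2=1$, $\zeta_i^2=1$ for $i=1,\dots,n-1$ (second Reidemeister moves; the one for $\zeta_i$ is called classical); (2) $\tau_i\zeta_i=\zeta_i\tau_i$ for $i=1,\dots,n-1$ (virtualization); (3) $\zeta_i\zeta_j=\zeta_j\zeta_i$, $\zeta_i\tau_j=\tau_j\zeta_i$, $\tau_i\tau_j=\tau_j\tau_i$ for $|i-j|\ge 2$ (far commutativity); (4) $\tau_i\tau_{i+1}\tau_i=\tau_{i+1}\tau_i\tau_{i+1}$ for $i=1,\dots,n-2$; (5) $\tau_i\tau_{i+1}\zeta_i=\zeta_{i+1}\tau_i\tau_{i+1}$ for $i=1,\dots,n-2$. The free $n$-strand braid group $\mathcal{FB}_n$ is the quotient of $\mathcal{F}_n$ by the relations $\zeta_i\zeta_{i+1}\zeta_i=\zeta_{i+1}\zeta_i\zeta_{i+1}$, $i=1,\dots,n-2$. A free $n$-strand braid is an element of $\mathcal{FB}_n$. A braid-word is a finite word in the letters $\zeta_i,\tau_i$ ($1\le i\le n-1$). Occurrences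 of letters $\zeta_i$ in a word are called classical crossings, occurrences of $\tau_i$ virtual crossings. A subword of a word is a word obtained from it by deleting some letters (not necessarily a contiguous block). **Strands.** A braid-word is drawn as a diagram read from top to bottom; each letter $\zeta_i$ or $\tau_i$ is a crossing at which the strands currently in positions $i$ and $i+1$ cross and exchange positions. Strands are numbered $1,\dots,n$ by their top endpoints and go straight through all crossings; each crossing lies on exactly two strands. ''Upper'' means first in the word, ''lower'' means last. **Parity.** Let $B$ be a set of free $n$-strand braids. A parity for braids from $B$ is a way of associating elements of $\mathbb{Z}_2$ (even $=0$, odd $=1$) with all classical crossings of all braid-words representing braids from $B$ such that: 1. If two braid-words $ApC$ and $AqC$ are obtained from one another by applying a defining relation $p\to q$ of $\mathcal{FB}_n$, then the parities of all crossings belonging to $A$ or to $C$ do not change. 2. For $\zeta_i\zeta_j\to\zeta_j\zeta_i$, $|i-j|\ge2$, the parity of $\zeta_i$ on the left-hand side equals that of $\zeta_i$ on the right-hand side, and likewise for $\zeta_j$. 3. For $\zeta_i\tau_j\to\tau_j\zeta_i$, $|i-j|\ge 2$, the parity of $\zeta_i$ does not change. 4. For $\zeta_i^2\to 1$, both letters $\zeta_i$ on the left have the same parity. 5. For $\zeta_i\zeta_{i+1}\zeta_i\to\zeta_{i+1}\zeta_i\zeta_{i+1}$: (a) the number of odd crossings among the three on the left is even; (b) the parity of the upper $\zeta_i$ on the left equals that of the lower $\zeta_{i+1}$ on the right; (c) the parity of the middle $\zeta_{i+1}$ on the left equals that of the middle $\zeta_i$ on the right; (d) the parity of the lower $\zeta_i$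 on the left equals that of the upper $\zeta_{i+1}$ on the right. 6. For $\tau_i\tau_{i+1}\zeta_i\to\zeta_{i+1}\tau_i\tau_{i+1}$, the parity of $\zeta_i$ on the left equals that of $\zeta_{i+1}$ on the right. 7. For $\zeta_i\tau_i\to\tau_i\zeta_i$, the parity of $\zeta_i$ does not change. **Strong equivalence.** Two braid-words are strongly equivalent if they are related by a sequence of the moves given by relations (1)-(5) of $\mathcal{F}_n$ except the classical second Reidemeister moves $\zeta_i^2=1$. **Bigons.** Let $x,x'$ be two distinct classical crossings of a braid-word $\beta$ lying on the same two strands of $\beta$, say numbers $i$ and $j$. They form a bigon if there is no classical crossing letter $\zeta_k$ in $\beta$ between the letters corresponding to $x$ and $x'$ that belongs to the $i$-th or the $j$-th strand. The bigon reduction is the operation deleting the letters $x,x'$ from $\beta$. *)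

(* Defs.v *)
From HB Require Import structures.
From Stdlib Require Export Relation_Operators.
From mathcomp Require Export all_boot all_order all_algebra.
From mathcomp Require Export boolp classical_sets.

Set Implicit Arguments.
Unset Strict Implicit.
Unset Printing Implicit Defensive.

Import Order.TTheory GRing.Theory.

Local Open Scope nat_scope.
Local Open Scope quotient_scope.

(* Contextual moves [A p C -> A q C] given by a set [R] of moves [p -> q]; the
   generated equivalence is a monoid congruence on words. *)
Definition move (X : Type) (R : seq X -> seq X -> Prop) (u v : seq X) : Prop :=
  exists A p q C, [/\ R p q, u = A ++ p ++ C & v = A ++ q ++ C].

Definition word_equiv (X : Type) (R : seq X -> seq X -> Prop) :
  seq X -> seq X -> Prop := clos_refl_sym_trans (seq X) (move R).

(* The group presented by generators [X] and relations [p = q], for [R p q]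
   between words in the generators. Its elements are classes of words in signed
   letters [(b, x)], where [(false, x)] is [x] and [(true, x)] its formal
   inverse. *)
Section PresentedGroup.
Variables (X : choiceType) (R : seq X -> seq X -> Prop).

Definition signed_word := seq (bool * X).

Definition positive (w : seq X) : signed_word := [seq (false, x) | x <- w].

Definition inv_word (w : signed_word) : signed_word :=
  rev [seq (~~ a.1, a.2) | a <- w].

Inductive group_rel : signed_word -> signed_word -> Prop :=
| GroupCancel b x : group_rel [:: (b, x); (~~ b, x)] [::]
| GroupRelation p q : R p q -> group_rel (positive p) (positive q).

Definition group_equiv := word_equiv group_rel.

Definition group_equivb (u v : signed_word) : bool := `[< group_equiv u v >].

Lemma group_equivb_refl : reflexive group_equivb.
Proof. by move=> u; apply/asboolP; apply: rst_refl. Qed.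

Lemma group_equivb_sym : symmetric group_equivb.
Proof. by move=> u v; apply/asboolP/asboolP; apply: rst_sym. Qed.

Lemma group_equivb_trans : transitive group_equivb.
Proof.
move=> v u w /asboolP uv /asboolP vw; apply/asboolP.
exact: rst_trans uv vw.
Qed.

Canonical group_equivb_equiv :=
  EquivRel group_equivb group_equivb_refl group_equivb_sym group_equivb_trans.

Definition presented_group := {eq_quot group_equivb}%qT.

HB.instance Definition _ := Choice.on presented_group.
HB.instance Definition _ := EqQuotient.on presented_group.

Definition signed_class (u : signed_word) : presented_group :=
  \pi_presented_group u.

Lemma signed_class_surj (a : presented_group) : exists u, a = signed_class u.
Proof. by exists (repr a); rewrite /signed_class reprK. Qed.

Lemma signed_classP (u v : signed_word) :
  signed_class u = signed_class v <-> group_equiv u v.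
Proof.
have piP := @eqmodP _ group_equivb_equiv u v.
by split=> [/piP/asboolP | uv] //; apply/piP/asboolP.
Qed.

Lemma group_equiv_cat u u' v v' :
  group_equiv u u' -> group_equiv v v' -> group_equiv (u ++ v) (u' ++ v').
Proof.
move=> uu' vv'; apply: (@rst_trans _ _ _ (u' ++ v)).
  elim: uu' => [_ _ [A [p [q [C [r -> ->]]]]]|w|w w' _|w1 w2 w3 _ h1 _ h2].
  - by apply: rst_step; exists A, p, q, (C ++ v); rewrite -!catA.
  - exact: rst_refl.
  - exact: rst_sym.
  - exact: rst_trans h1 h2.
elim: vv' => [_ _ [A [p [q [C [r -> ->]]]]]|w|w w' _|w1 w2 w3 _ h1 _ h2].
- by apply: rst_step; exists (u' ++ A), p, q, C; rewrite -!catA.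
- exact: rst_refl.
- exact: rst_sym.
- exact: rst_trans h1 h2.
Qed.

Lemma inv_wordK : involutive inv_word.
Proof.
move=> w; rewrite /inv_word map_rev revK -map_comp -[RHS]map_id.
by apply: eq_map => -[b x] /=; rewrite negbK.
Qed.

Lemma inv_word_cat u v : inv_word (u ++ v) = inv_word v ++ inv_word u.
Proof. by rewrite /inv_word map_cat rev_cat. Qed.

Lemma group_equiv_mulV u : group_equiv (u ++ inv_word u) [::].
Proof.
elim: u => [|[b x] u IH]; first exact: rst_refl.
rewrite -cat1s inv_word_cat -catA.
apply: (@rst_trans _ _ _ ([:: (b, x)] ++ inv_word [:: (b, x)])).
  rewrite (catA u).
  apply: group_equiv_cat; first exact: rst_refl.
  rewrite -[X in group_equiv _ X]cat0s.
  by apply: group_equiv_cat; [apply: IH | apply: rst_refl].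
apply: rst_step; exists [::], [:: (b, x); (~~ b, x)], [::], [::].
by split=> //; apply: GroupCancel.
Qed.

Lemma group_equiv_Vmul u : group_equiv (inv_word u ++ u) [::].
Proof. by rewrite -{2}(inv_wordK u); apply: group_equiv_mulV. Qed.

Lemma group_equiv_inv u v :
  group_equiv u v -> group_equiv (inv_word u) (inv_word v).
Proof.
move=> uv.
have h1 : group_equiv (inv_word u ++ [::]) (inv_word u ++ (v ++ inv_word v)).
  apply: group_equiv_cat; first exact: rst_refl.
  by apply: rst_sym; apply: group_equiv_mulV.
have h2 : group_equiv (inv_word u ++ (v ++ inv_word v)) ([::] ++ inv_word v).
  rewrite catA; apply: group_equiv_cat; last exact: rst_refl.
  apply: rst_trans (group_equiv_Vmul u).
  by apply: group_equiv_cat; [apply: rst_refl | apply: rst_sym].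
by rewrite cats0 in h1; apply: rst_trans h1 h2.
Qed.

Definition presented_one : presented_group := signed_class [::].
Definition presented_mul (a b : presented_group) : presented_group :=
  signed_class (repr a ++ repr b).
Definition presented_inv (a : presented_group) : presented_group :=
  signed_class (inv_word (repr a)).

Lemma repr_class_equiv u : group_equiv (repr (signed_class u)) u.
Proof. by apply/signed_classP; rewrite /signed_class reprK. Qed.

Lemma presented_mulE u v :
  presented_mul (signed_class u) (signed_class v) = signed_class (u ++ v).
Proof.
by apply/signed_classP; apply: group_equiv_cat; apply: repr_class_equiv.
Qed.

Lemma presented_invE u :
  presented_inv (signed_class u) = signed_class (inv_word u).
Proof.
by apply/signed_classP; apply: group_equiv_inv; apply: repr_class_equiv.
Qed.

Lemma presented_mulA : associative presented_mul.
Proof.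
move=> a b c.
have [u ->] := signed_class_surj a.
have [v ->] := signed_class_surj b.
have [w ->] := signed_class_surj c.
by rewrite !presented_mulE catA.
Qed.

Lemma presented_mul1 : left_id presented_one presented_mul.
Proof. by move=> a; have [u ->] := signed_class_surj a; rewrite presented_mulE. Qed.

Lemma presented_mulr1 : right_id presented_one presented_mul.
Proof.
by move=> a; have [u ->] := signed_class_surj a; rewrite presented_mulE cats0.
Qed.

Lemma presented_mulV : left_inverse presented_one presented_inv presented_mul.
Proof.
move=> a; have [u ->] := signed_class_surj a.
rewrite presented_invE presented_mulE.
by apply/signed_classP; apply: group_equiv_Vmul.
Qed.

Lemma presented_mulrV : right_inverse presented_one presented_inv presented_mul.
Proof.
move=> a; have [u ->] := signed_class_surj a.
rewrite presented_invE presented_mulE.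
by apply/signed_classP; apply: group_equiv_mulV.
Qed.

HB.instance Definition _ := isGroup.Build presented_group
  presented_mulA presented_mul1 presented_mulr1 presented_mulV presented_mulrV.

Definition word_class (w : seq X) : presented_group :=
  signed_class (positive w).

Definition generator (x : X) : presented_group := word_class [:: x].

Lemma word_class_prod w : word_class w = (\prod_(x <- w) generator x)%g.
Proof.
elim: w => [|x w IH]; first by rewrite big_nil.
by rewrite big_cons -IH; apply/esym/presented_mulE.
Qed.

End PresentedGroup.

(* Indices, positions and strands are numbered from 0: the letters zeta_k, tau_k
   ([1 <= k <= n - 1]) have index [k - 1 : 'I_n.-1], and exchange the positions
   [k - 1] and [k] among [0, ..., n - 1]. *)
Inductive letter (n : nat) : Type := Zeta of 'I_n.-1 | Tau of 'I_n.-1.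
Arguments Zeta {n}.
Arguments Tau {n}.

Definition letter_to_sum n (a : letter n) : 'I_n.-1 + 'I_n.-1 :=
  match a with Zeta i => inl i | Tau i => inr i end.

Definition sum_to_letter n (s : 'I_n.-1 + 'I_n.-1) : letter n :=
  match s with inl i => Zeta i | inr i => Tau i end.

Lemma letter_to_sumK n : cancel (@letter_to_sum n) (@sum_to_letter n).
Proof. by case. Qed.

HB.instance Definition _ n :=
  Finite.copy (letter n) (can_type (@letter_to_sumK n)).

Definition letter_index n (a : letter n) : 'I_n.-1 :=
  match a with Zeta i => i | Tau i => i end.

Definition braid_word (n : nat) := seq (letter n).

Definition far (i j : nat) : bool := (i.+2 <= j) || (j.+2 <= i).

(* The defining relations of the group F_n, except [zeta_i ^ 2 = 1]. *)
Inductive strong_rel n : braid_word n -> braid_word n -> Prop :=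
| TauTau i : strong_rel [:: Tau i; Tau i] [::]
| Virtualization i : strong_rel [:: Zeta i; Tau i] [:: Tau i; Zeta i]
| FarZetaZeta (i j : 'I_n.-1) : far i j ->
    strong_rel [:: Zeta i; Zeta j] [:: Zeta j; Zeta i]
| FarZetaTau (i j : 'I_n.-1) : far i j ->
    strong_rel [:: Zeta i; Tau j] [:: Tau j; Zeta i]
| FarTauTau (i j : 'I_n.-1) : far i j ->
    strong_rel [:: Tau i; Tau j] [:: Tau j; Tau i]
| TauBraid (i j : 'I_n.-1) : j = i.+1 :> nat ->
    strong_rel [:: Tau i; Tau j; Tau i] [:: Tau j; Tau i; Tau j]
| TauTauZeta (i j : 'I_n.-1) : j = i.+1 :> nat ->
    strong_rel [:: Tau i; Tau j; Zeta i] [:: Zeta j; Tau i; Tau j].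

Inductive F_rel n : braid_word n -> braid_word n -> Prop :=
| FStrong p q : strong_rel p q -> F_rel p q
| ZetaZeta i : F_rel [:: Zeta i; Zeta i] [::].

Inductive FB_rel n : braid_word n -> braid_word n -> Prop :=
| FBF p q : F_rel p q -> FB_rel p q
| ZetaBraid (i j : 'I_n.-1) : j = i.+1 :> nat ->
    FB_rel [:: Zeta i; Zeta j; Zeta i] [:: Zeta j; Zeta i; Zeta j].

Definition free_braid (n : nat) := presented_group (@FB_rel n).

HB.instance Definition _ n := Group.on (free_braid n).

Definition braid_of n (w : braid_word n) : free_braid n :=
  word_class (@FB_rel n) w.

Definition strongly_equivalent n : braid_word n -> braid_word n -> Prop :=
  word_equiv (@strong_rel n).

(* A crossing of a word is the position (from 0) of its letter in the word. *)
Definition classical n (w : braid_word n) (k : nat) : bool :=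
  if onth w k is Some (Zeta _) then true else false.

(* The parity of the crossing [k] of [w] is [par w k]; the values of [par] at
   positions that are not classical crossings, and on words representing no
   braid of [B], are irrelevant. *)
Definition is_odd n (par : braid_word n -> nat -> 'Z_2) (w : braid_word n)
  (k : nat) : bool := par w k == 1%R.

Record parity n (B : set (free_braid n)) (par : braid_word n -> nat -> 'Z_2) :
    Prop := Parity {
  parity_above : forall A C p q : braid_word n,
    FB_rel p q -> B (braid_of (A ++ p ++ C)) ->
    forall k, classical A k ->
      par (A ++ p ++ C) k = par (A ++ q ++ C) k;
  parity_below : forall A C p q : braid_word n,
    FB_rel p q -> B (braid_of (A ++ p ++ C)) ->
    forall k, classical C k ->
      par (A ++ p ++ C) (size A + size p + k) =
      par (A ++ q ++ C) (size A + size q + k);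
  parity_far_zeta : forall (A C : braid_word n) (i j : 'I_n.-1),
    far i j ->
    let u := A ++ [:: Zeta i; Zeta j] ++ C in
    let v := A ++ [:: Zeta j; Zeta i] ++ C in
    B (braid_of u) ->
    par u (size A) = par v (size A + 1) /\ par u (size A + 1) = par v (size A);
  parity_far_tau : forall (A C : braid_word n) (i j : 'I_n.-1),
    far i j ->
    let u := A ++ [:: Zeta i; Tau j] ++ C in
    let v := A ++ [:: Tau j; Zeta i] ++ C in
    B (braid_of u) -> par u (size A) = par v (size A + 1);
  parity_zeta2 : forall (A C : braid_word n) (i : 'I_n.-1),
    let u := A ++ [:: Zeta i; Zeta i] ++ C in
    B (braid_of u) -> par u (size A) = par u (size A + 1);
  parity_zeta3 : forall (A C : braid_word n) (i j : 'I_n.-1),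
    j = i.+1 :> nat ->
    let u := A ++ [:: Zeta i; Zeta j; Zeta i] ++ C in
    let v := A ++ [:: Zeta j; Zeta i; Zeta j] ++ C in
    B (braid_of u) ->
    [/\ ~~ odd (is_odd par u (size A) + is_odd par u (size A + 1) +
                is_odd par u (size A + 2)),
        par u (size A) = par v (size A + 2),
        par u (size A + 1) = par v (size A + 1)
      & par u (size A + 2) = par v (size A)];
  parity_mixed : forall (A C : braid_word n) (i j : 'I_n.-1),
    j = i.+1 :> nat ->
    let u := A ++ [:: Tau i; Tau j; Zeta i] ++ C in
    let v := A ++ [:: Zeta j; Tau i; Tau j] ++ C in
    B (braid_of u) -> par u (size A + 2) = par v (size A);
  parity_virtualization : forall (A C : braid_word n) (i : 'I_n.-1),
    let u := A ++ [:: Zeta i; Tau i] ++ C in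
    let v := A ++ [:: Tau i; Zeta i] ++ C in
    B (braid_of u) -> par u (size A) = par v (size A + 1)
}.

Definition exchange (i k : nat) : nat :=
  if k == i then i.+1 else if k == i.+1 then i else k.

(* The strand in position [k] at the bottom of [w], found by following it
   upwards from the last letter to the first. *)
Definition strand_at n (w : braid_word n) (k : nat) : nat :=
  foldr (fun a => exchange (letter_index a)) k w.

Definition on_strand n (w : braid_word n) (k s : nat) : bool :=
  if onth w k is Some a then
    s \in [:: strand_at (take k w) (letter_index a);
              strand_at (take k w) (letter_index a).+1]
  else false.

(* [x] is the upper crossing of the bigon and [x'] the lower one. *)
Definition bigon n (w : braid_word n) (x x' : nat) : Prop :=
  [/\ x < x', classical w x, classical w x'
    & exists i j, [/\ i != j,
        on_strand w x i && on_strand w x j,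
        on_strand w x' i && on_strand w x' j
      & forall y, x < y < x' -> classical w y ->
          ~~ on_strand w y i && ~~ on_strand w y j]].

Definition delete_at n (k : nat) (w : braid_word n) : braid_word n :=
  take k w ++ drop k.+1 w.

Definition bigon_reduction n (w w' : braid_word n) : Prop :=
  exists x x', bigon w x x' /\ w' = delete_at x (delete_at x' w).

(* Main.v *)
(** Deleting the even classical crossings turns each move between words
   representing braids of [B] into a chain of moves of [F_n]: by clause 5(a) the
   third Reidemeister move keeps at most two of its crossings, and then becomes
   an equality of words or two second Reidemeister moves. This deletion fixes
   [beta], so the odd part of [beta'] is a subword equal to [beta] in [F_n].

   [F_n] is the semidirect product of a right-angled Coxeter group by the
   symmetric group generated by the [tau_i]: the Coxeter generators are the
   unordered pairs of strands, disjoint pairs commute, and a word is sent to the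
   sequence of strand pairs of its classical crossings together with its
   permutation. In the same way, words up to strong equivalence are the
   semidirect product of a partially commutative monoid by the symmetric group.
   Bigon reductions are the cancellations of the Coxeter group, so applying them
   to the odd part of [beta'] yields a subword [s] whose sequence of pairs is
   reduced, as is the one of [beta]. Reduced words of a right-angled Coxeter
   group that represent the same element differ by commutations only; hence [s]
   and [beta] are strongly equivalent. *)
From HB Require Import structures.
Require Import Defs.
From mathcomp Require Import zify.

Set Implicit Arguments.
Unset Strict Implicit.
Unset Printing Implicit Defensive.

Local Open Scope nat_scope.

(** * Congruences generated by moves on words *)

Section WordEquivalence.
Variables (X : Type) (R : seq X -> seq X -> Prop).

(** Induction principle behind every invariant below: only a single contextual move has to be
    checked by hand. *)
Lemma word_equiv_min (E : seq X -> seq X -> Prop) :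
    (forall u, E u u) -> (forall u v, E u v -> E v u) ->
    (forall u v w, E u v -> E v w -> E u w) ->
    (forall A p q C, R p q -> E (A ++ p ++ C) (A ++ q ++ C)) ->
  forall u v, word_equiv R u v -> E u v.
Proof.
move=> Er Es Et ER u v; elim=> {u v}.
- by move=> _ _ [A [p [q [C [Rpq -> ->]]]]]; apply: ER.
- exact: Er.
- by move=> u v _; apply: Es.
- by move=> u v w _ uv _; apply: Et uv.
Qed.

Lemma word_equiv_rel A p q C :
  R p q -> word_equiv R (A ++ p ++ C) (A ++ q ++ C).
Proof. by move=> Rpq; apply: rst_step; exists A, p, q, C. Qed.

Lemma word_equiv_base p q : R p q -> word_equiv R p q.
Proof. by move=> /(word_equiv_rel [::] [::]); rewrite !cats0. Qed.

Lemma word_equiv_cat u u' v v' :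
  word_equiv R u u' -> word_equiv R v v' -> word_equiv R (u ++ v) (u' ++ v').
Proof.
move=> uu' vv'; apply: (@rst_trans _ _ _ (u' ++ v)).
  apply: (word_equiv_min (E := fun a b => word_equiv R (a ++ v) (b ++ v))) uu'.
  - by move=> a; apply: rst_refl.
  - by move=> a b; apply: rst_sym.
  - by move=> a b c; apply: rst_trans.
  - by move=> A p q C Rpq; rewrite -!catA; apply: word_equiv_rel.
apply: (word_equiv_min (E := fun a b => word_equiv R (u' ++ a) (u' ++ b))) vv'.
- by move=> a; apply: rst_refl.
- by move=> a b; apply: rst_sym.
- by move=> a b c; apply: rst_trans.
- by move=> A p q C Rpq; rewrite !(catA u'); apply: word_equiv_rel.
Qed.

Lemma word_equiv_cons x u v :
  word_equiv R u v -> word_equiv R (x :: u) (x :: v).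
Proof.
by move=> uv; apply: (@word_equiv_cat [:: x] [:: x]) uv; apply: rst_refl.
Qed.

End WordEquivalence.

(** * Right-angled Coxeter groups *)

Section CoxeterWords.
Variables (X : eqType) (comm : rel X).
Hypothesis comm_sym : symmetric comm.
Hypothesis comm_irr : irreflexive comm.

Inductive comm_rel : seq X -> seq X -> Prop :=
| CommSwap p q : comm p q -> comm_rel [:: p; q] [:: q; p].

Inductive coxeter_rel : seq X -> seq X -> Prop :=
| CoxeterSwap p q : comm p q -> coxeter_rel [:: p; q] [:: q; p]
| CoxeterSquare p : coxeter_rel [:: p; p] [::].

Local Notation "u =c v" := (word_equiv comm_rel u v) (at level 70).

Lemma comm_swap A p q C :
  comm p q -> A ++ [:: p, q & C] =c A ++ [:: q, p & C].
Proof. by move=> pq; apply: (word_equiv_rel A C (CommSwap pq)). Qed.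

(** Left division by [a] in the partially commutative monoid: [Some r] is the quotient, and [None]
    means that no [a] can be commuted to the front. *)
Fixpoint pull (a : X) (l : seq X) : option (seq X) :=
  if l is b :: l' then
    if b == a then Some l'
    else if comm a b then omap (cons b) (pull a l') else None
  else None.

(** That is, no two equal letters can be brought together by commutations. *)
Fixpoint reduced (l : seq X) : bool :=
  if l is a :: l' then (pull a l' == None) && reduced l' else true.

(* Left multiplication by [a] on reduced words; it is an involution up to
   commutations, so that [normal_form] is a Coxeter group invariant. *)
Definition toggle (a : X) (l : seq X) : seq X :=
  if pull a l is Some r then r else a :: l.

Definition normal_form (l : seq X) : seq X := foldr toggle [::] l.

(** Makes left division well defined on the partially commutative monoid. The one real case is a
    swap at the head, where irreflexivity of [comm] ensures that at most one of the two letters is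
    [a]. *)
Lemma pull_comm a u v : u =c v ->
  match pull a u, pull a v with
  | Some r, Some s => r =c s
  | None, None => True
  | _, _ => False
  end.
Proof.
move: u v; apply: word_equiv_min.
- by move=> u; case: (pull a u) => // r; apply: rst_refl.
- move=> u v; case: (pull a u) => [r|]; case: (pull a v) => [s|] //.
  exact: rst_sym.
- move=> u v w.
  case: (pull a u) => [r|]; case: (pull a v) => [s|];
    case: (pull a w) => [t|] //; exact: rst_trans.
move=> A _ _ C [p q pq].
elim: A => [|b A IH] /=.
  have swap r : [:: p, q & r] =c [:: q, p & r] by apply: (@comm_swap [::]).
  have [pa|pa] /= := eqVneq p a.
    have qa : q == a = false by apply/eqP=> qa; rewrite pa qa comm_irr in pq.
    by rewrite qa -pa pq; apply: rst_refl.
  have [qa|qa] /= := eqVneq q a.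
    by rewrite -qa comm_sym pq /=; apply: rst_refl.
  case: ifP => ap; case: ifP => aq //=.
  by case: (pull a C).
case: ifP => _; first exact: comm_swap.
case: ifP => // _; move: IH.
case: (pull a (A ++ _)) => [r|]; case: (pull a (A ++ _)) => [s|] //=.
exact: word_equiv_cons.
Qed.

Lemma pull_some a u r : pull a u = Some r -> u =c a :: r.
Proof.
elim: u r => //= b u IH r.
have [->|ba] /= := eqVneq b a; first by case=> ->; apply: rst_refl.
case: ifP => // ab; case: (pull a u) IH => //= s /(_ _ erefl) us [<-].
apply: (@rst_trans _ _ _ [:: b, a & s]); first exact: word_equiv_cons.
by apply: (@comm_swap [::]); rewrite comm_sym.
Qed.

Lemma pull_head a u : pull a (a :: u) = Some u.
Proof. by rewrite /= eqxx. Qed.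

Lemma pull_none a u v : u =c v -> (pull a u == None) = (pull a v == None).
Proof. by move/(pull_comm a); case: (pull a u); case: (pull a v). Qed.

Lemma reduced_comm u v : u =c v -> reduced u = reduced v.
Proof.
move: u v; apply: word_equiv_min => //; first by move=> u v w -> ->.
move=> A _ _ C [p q pq]; elim: A => [|b A IH] /=.
  have qp : q == p = false by apply/eqP=> qp; rewrite qp comm_irr in pq.
  rewrite qp (eq_sym p) qp pq comm_sym pq /=.
  by case: (pull p C) => [r|]; case: (pull q C) => [s|].
congr (_ && _) => //; exact/pull_none/comm_swap.
Qed.

Lemma pull_reduced a u r :
  reduced u -> pull a u = Some r -> pull a r = None /\ reduced r.
Proof.
move=> ru /pull_some ur; move: ru; rewrite (reduced_comm ur) /=.
by case/andP=> /eqP.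
Qed.

Lemma toggle_reduced a u : reduced u -> reduced (toggle a u).
Proof.
rewrite /toggle => ru; case E: (pull a u) => [r|] /=; last by rewrite E.
by case: (pull_reduced ru E).
Qed.

Lemma toggle_comm a u v : u =c v -> toggle a u =c toggle a v.
Proof.
move=> uv; have := pull_comm a uv; rewrite /toggle.
case: (pull a u) => [r|]; case: (pull a v) => [s|] //.
by move=> _; apply: word_equiv_cons.
Qed.

(** Reducedness prevents a second division by [a] after a first one, so the second toggle puts the
    letter back. *)
Lemma toggleK a u : reduced u -> toggle a (toggle a u) =c u.
Proof.
rewrite {2}/toggle => ru; case E: (pull a u) => [r|] /=.
  have [pr _] := pull_reduced ru E.
  by rewrite /toggle pr; apply: rst_sym; apply: pull_some.
by rewrite /toggle pull_head; apply: rst_refl.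
Qed.

Lemma toggle_cons a b u : comm a b -> toggle a (b :: u) =c b :: toggle a u.
Proof.
move=> ab; rewrite /toggle /= ab.
have -> : b == a = false by apply/eqP=> ba; rewrite ba comm_irr in ab.
case: (pull a u) => [r|] /=; first exact: rst_refl.
exact: (@comm_swap [::]).
Qed.

Lemma toggle_some a b u r :
  comm a b -> pull a u = Some r ->
  toggle a (toggle b u) =c toggle b (toggle a u).
Proof.
move=> ab E; have uE := pull_some E.
have -> : toggle a u = r by rewrite /toggle E.
apply: (@rst_trans _ _ _ (toggle a (toggle b (a :: r)))).
  by do 2!apply: toggle_comm.
apply: (@rst_trans _ _ _ (toggle a (a :: toggle b r))).
  by apply/toggle_comm/toggle_cons; rewrite comm_sym.
by rewrite {1}/toggle pull_head; apply: rst_refl.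
Qed.

(** If one letter can be pulled from [u], that letter is written in front of [u]; if neither can,
    both sides prepend the two letters and differ by one swap. *)
Lemma toggleC a b u :
  comm a b -> toggle a (toggle b u) =c toggle b (toggle a u).
Proof.
move=> ab; have ba : comm b a by rewrite comm_sym.
case Ea: (pull a u) => [r|]; first exact: toggle_some Ea.
case Eb: (pull b u) => [s|]; first by apply: rst_sym; apply: toggle_some Eb.
have -> : toggle a u = a :: u by rewrite /toggle Ea.
have -> : toggle b u = b :: u by rewrite /toggle Eb.
apply: (@rst_trans _ _ _ (b :: toggle a u)); first exact: toggle_cons.
apply: (@rst_trans _ _ _ (a :: toggle b u)); last first.
  by apply: rst_sym; apply: toggle_cons.
rewrite /toggle Ea Eb; exact: (@comm_swap [::]).
Qed.

Lemma normal_form_reduced u : reduced (normal_form u).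
Proof. by elim: u => //= a u; apply: toggle_reduced. Qed.

Lemma reduced_normal_form u : reduced u -> normal_form u = u.
Proof.
by elim: u => //= a u IH /andP[/eqP E /IH ->]; rewrite /toggle E.
Qed.

Lemma normal_form_coxeter u v :
  word_equiv coxeter_rel u v -> normal_form u =c normal_form v.
Proof.
move: u v; apply: word_equiv_min.
- by move=> u; apply: rst_refl.
- by move=> u v; apply: rst_sym.
- by move=> u v w; apply: rst_trans.
move=> A p q C pq; elim: A => [|b A IH] /=; last exact: toggle_comm.
case: pq => [a b ab|a] /=; first exact: toggleC.
exact/toggleK/normal_form_reduced.
Qed.

(** Solution of the word problem: a reduced word is its own normal form, and normal forms are
    Coxeter invariants up to commutations. *)
Lemma reduced_coxeter u v :
  reduced u -> reduced v -> word_equiv coxeter_rel u v -> u =c v.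
Proof.
move=> ru rv /normal_form_coxeter.
by rewrite !reduced_normal_form.
Qed.

Lemma coxeter_delete p u :
  all (comm p) u -> word_equiv coxeter_rel (p :: rcons u p) u.
Proof.
elim: u => [|q u IH] /=.
  by move=> _; apply: (word_equiv_rel [::] [::] (CoxeterSquare p)).
case/andP=> pq /IH pu; apply: (@rst_trans _ _ _ [:: q, p & rcons u p]).
  exact: (word_equiv_rel [::] (rcons u p) (CoxeterSwap pq)).
exact: word_equiv_cons.
Qed.

End CoxeterWords.

(** * Words up to strong equivalence *)

Definition permute (s : seq nat) (k : nat) : nat := foldr exchange k s.

Lemma permute_cat s t k : permute (s ++ t) k = permute s (permute t k).
Proof. by rewrite /permute foldr_cat. Qed.

Lemma exchangeK i : involutive (exchange i).
Proof. by move=> k; rewrite /exchange; repeat case: eqP; lia. Qed.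

Lemma exchange_l i : exchange i i = i.+1.
Proof. by rewrite /exchange eqxx. Qed.

Lemma exchange_r i : exchange i i.+1 = i.
Proof. by rewrite -exchange_l exchangeK. Qed.

Lemma permute_rev s : cancel (permute s) (permute (rev s)).
Proof.
elim: s => // a s IH k.
by rewrite rev_cons -cats1 permute_cat /= exchangeK IH.
Qed.

Lemma permute_revK s : cancel (permute (rev s)) (permute s).
Proof. by move=> k; rewrite -{1}[s]revK permute_rev. Qed.

Lemma permute_inj s : injective (permute s).
Proof. exact: can_inj (@permute_rev s). Qed.

Lemma permute_fix N s k : all (gtn N) s -> N < k -> permute s k = k.
Proof.
elim: s => //= a s IH /andP[aN /IH E] /[dup] Nk /E ->.
by rewrite /exchange; repeat case: eqP; lia.
Qed.

Lemma permute_le N s k : all (gtn N) s -> k <= N -> permute s k <= N.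
Proof.
move=> sN kN; elim: s sN => //= a s IH /andP[aN /IH].
by rewrite /exchange; repeat case: eqP; lia.
Qed.

(** The cycle that takes [j] to [j + d] and shifts the positions in between down by one. For
    [j + d = k.+1] these are coset representatives of the symmetric group on [0, ..., k] in the one
    on [0, ..., k.+1]. *)
Definition descent (j d : nat) : seq nat := rev (iota j d).

Lemma descentS j d : descent j d.+1 = rcons (descent j.+1 d) j.
Proof. by rewrite /descent /= rev_cons. Qed.

Lemma permute_descent j d k : permute (descent j d) k =
  if k < j then k else if k == j then j + d else if k <= j + d then k.-1 else k.
Proof.
elim: d j k => [|d IH] j k /=; first by repeat case: ifP; lia.
rewrite descentS -cats1 permute_cat IH /= /exchange.
by repeat case: eqP; repeat case: ifP; lia.
Qed.

(** * The monoid of braid-words up to strong equivalence *)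

Section StrongMonoid.
Variable n : nat.

Definition strongb (u v : braid_word n) : bool :=
  `[< strongly_equivalent u v >].

Lemma strongb_refl : reflexive strongb.
Proof. by move=> u; apply/asboolP; apply: rst_refl. Qed.

Lemma strongb_sym : symmetric strongb.
Proof. by move=> u v; apply/asboolP/asboolP; apply: rst_sym. Qed.

Lemma strongb_trans : transitive strongb.
Proof.
by move=> v u w /asboolP uv /asboolP vw; apply/asboolP; apply: rst_trans vw.
Qed.

Canonical strongb_equiv :=
  EquivRel strongb strongb_refl strongb_sym strongb_trans.

Definition strong_monoid := {eq_quot strongb}%qT.

HB.instance Definition _ := Choice.on strong_monoid.
HB.instance Definition _ := EqQuotient.on strong_monoid.

Definition strong_class (u : braid_word n) : strong_monoid :=
  (\pi_strong_monoid u)%qT.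

Lemma strong_classP u v :
  strong_class u = strong_class v <-> strongly_equivalent u v.
Proof.
have piP := @eqmodP _ strongb_equiv u v.
by split=> [/piP/asboolP | uv] //; apply/piP/asboolP.
Qed.

Definition strong_mul (a b : strong_monoid) : strong_monoid :=
  strong_class (repr a ++ repr b)%qT.

Lemma strong_class_repr a : strong_class (repr a)%qT = a.
Proof. by rewrite /strong_class reprK. Qed.

Lemma strong_mulE u v :
  strong_mul (strong_class u) (strong_class v) = strong_class (u ++ v).
Proof.
apply/strong_classP.
by apply: word_equiv_cat; apply/strong_classP; rewrite strong_class_repr.
Qed.

Lemma strong_mulA : associative strong_mul.
Proof.
move=> a b c; rewrite -(strong_class_repr a) -(strong_class_repr b).
by rewrite -(strong_class_repr c) !strong_mulE catA.
Qed.

Lemma strong_mul1 : left_id (strong_class [::]) strong_mul.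
Proof. by move=> a; rewrite -(strong_class_repr a) strong_mulE. Qed.

Lemma strong_mulr1 : right_id (strong_class [::]) strong_mul.
Proof. by move=> a; rewrite -(strong_class_repr a) strong_mulE cats0. Qed.

HB.instance Definition _ :=
  isMonoid.Build strong_monoid strong_mulA strong_mul1 strong_mulr1.

End StrongMonoid.

(** * The symmetric group generated by the virtual letters *)

Section StrongRelations.
Variable n : nat.
Implicit Types (i j k : nat) (s t : seq nat).
Local Open Scope group_scope.
Local Notation N := n.-1.

Lemma strong_class_cat (u v : braid_word n) :
  strong_class (u ++ v) = strong_class u * strong_class v.
Proof. by rewrite [RHS]strong_mulE. Qed.

(** Natural indices, with value [1] out of range, keep bound proofs out of the index arithmetic. *)
Definition tau k : strong_monoid n :=
  if insub k is Some i then strong_class [:: Tau i] else 1.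

Definition zeta k : strong_monoid n :=
  if insub k is Some i then strong_class [:: Zeta i] else 1.

Lemma tau_ord (i : 'I_N) : tau i = strong_class [:: Tau i].
Proof. by rewrite /tau valK. Qed.

Lemma zeta_ord (i : 'I_N) : zeta i = strong_class [:: Zeta i].
Proof. by rewrite /zeta valK. Qed.

Lemma strong_class_rel (p q : braid_word n) :
  strong_rel p q -> strong_class p = strong_class q.
Proof.
by move=> pq; apply/strong_classP/word_equiv_base.
Qed.

Lemma tauK k : tau k * tau k = 1.
Proof.
rewrite /tau; case: insubP => [i _ _|_]; last by rewrite mulg1.
rewrite -strong_class_cat; exact/strong_class_rel/TauTau.
Qed.

Lemma zeta_tau k : zeta k * tau k = tau k * zeta k.
Proof.
rewrite /tau /zeta; case: insubP => [i _ _|_] //.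
rewrite -!strong_class_cat; exact/strong_class_rel/Virtualization.
Qed.

Lemma tau_far j k : far j k -> tau j * tau k = tau k * tau j.
Proof.
rewrite /tau; case: insubP => [i _ <-|_]; last by rewrite mulg1 mul1g.
case: insubP => [i' _ <-|_]; last by rewrite mulg1 mul1g.
by move=> ii'; rewrite -!strong_class_cat; apply/strong_class_rel/FarTauTau.
Qed.

Lemma zeta_tau_far j k : far j k -> zeta j * tau k = tau k * zeta j.
Proof.
rewrite /tau /zeta; case: insubP => [i _ <-|_]; last by rewrite mulg1 mul1g.
case: insubP => [i' _ <-|_]; last by rewrite mulg1 mul1g.
by move=> ii'; rewrite -!strong_class_cat; apply/strong_class_rel/FarZetaTau.
Qed.

Lemma zeta_far j k : far j k -> zeta j * zeta k = zeta k * zeta j.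
Proof.
rewrite /zeta; case: insubP => [i _ <-|_]; last by rewrite mulg1 mul1g.
case: insubP => [i' _ <-|_]; last by rewrite mulg1 mul1g.
by move=> ii'; rewrite -!strong_class_cat; apply/strong_class_rel/FarZetaZeta.
Qed.

Lemma tau_braid k : k.+1 < N ->
  tau k * tau k.+1 * tau k = tau k.+1 * tau k * tau k.+1.
Proof.
move=> kN; rewrite /tau; case: insubP => [i _ ik|]; last by lia.
case: insubP => [i' _ ik'|]; last by lia.
rewrite -!strong_class_cat; apply/strong_class_rel/TauBraid.
by rewrite ik'; congr _.+1.
Qed.

Lemma tau_tau_zeta k : k.+1 < N ->
  tau k * tau k.+1 * zeta k = zeta k.+1 * tau k * tau k.+1.
Proof.
move=> kN; rewrite /tau /zeta; case: insubP => [i _ ik|]; last by lia.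
case: insubP => [i' _ ik'|]; last by lia.
rewrite -!strong_class_cat; apply/strong_class_rel/TauTauZeta.
by rewrite ik'; congr _.+1.
Qed.

Definition taus s : strong_monoid n := \prod_(i <- s) tau i.

Lemma taus_nil : taus [::] = 1.
Proof. by rewrite /taus big_nil. Qed.

Lemma taus_cat s t : taus (s ++ t) = taus s * taus t.
Proof. by rewrite /taus big_cat. Qed.

Lemma taus_cons k s : taus (k :: s) = tau k * taus s.
Proof. by rewrite /taus big_cons. Qed.

Lemma taus1 k : taus [:: k] = tau k.
Proof. by rewrite /taus big_seq1. Qed.

Lemma taus_rcons s k : taus (rcons s k) = taus s * tau k.
Proof. by rewrite -cats1 taus_cat taus1. Qed.

Lemma taus_rev s : taus (rev s) * taus s = 1.
Proof.
elim: s => [|k s IH]; first by rewrite taus_nil mulg1.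
rewrite rev_cons taus_rcons taus_cons mulgA.
by rewrite -(mulgA _ (tau k) (tau k)) tauK mulg1.
Qed.

Lemma taus_revK s : taus s * taus (rev s) = 1.
Proof. by rewrite -{1}[s]revK taus_rev. Qed.

Lemma commute_taus (x : strong_monoid n) s :
  {in s, forall i, x * tau i = tau i * x} -> x * taus s = taus s * x.
Proof.
elim: s => [|k s IH] xs; first by rewrite taus_nil mulg1 mul1g.
rewrite taus_cons mulgA xs ?mem_head // -mulgA IH ?mulgA // => i si.
by rewrite xs // in_cons si orbT.
Qed.

Lemma far_descent i j d : i.+1 < j ->
  tau i * taus (descent j d) = taus (descent j d) * tau i.
Proof.
move=> ij; apply: commute_taus => k; rewrite mem_rev mem_iota => jk.
by apply: tau_far; rewrite /far; lia.
Qed.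

(** Moving left, [tau i] commutes with the letters below [i.-1], turns into [tau i.-1] by the braid
    relation, and then commutes with the letters above [i]. *)
Lemma descent_slide i j d : j < i < j + d -> j + d <= N ->
  taus (descent j d) * tau i = tau i.-1 * taus (descent j d).
Proof.
elim: d j => [|d IH] j; first lia.
rewrite descentS taus_rcons => jid jdN.
have [ij|ij] := eqVneq i j.+1; last first.
  rewrite -mulgA -(@tau_far i j); last by rewrite /far; lia.
  by rewrite !mulgA IH //; lia.
case: d jid jdN {IH} => [|d] jid jdN; first lia.
rewrite descentS taus_rcons ij /= -!mulgA (mulgA (tau j.+1)) -tau_braid; last lia.
by rewrite !mulgA far_descent //; lia.
Qed.

(* Coset normal form for the symmetric group: the second factor is determined
   by the point sent to [k.+1]. *)
Lemma taus_normal_form k s : k < N -> all (gtn k.+1) s ->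
  exists u j d, [/\ all (gtn k) u, j + d = k.+1,
    taus s = taus (u ++ descent j d) & permute s =1 permute (u ++ descent j d)].
Proof.
move=> kN; elim/last_ind: s => [|s i IH].
  by move=> _; exists [::], k.+1, 0; split=> //; rewrite addn0.
rewrite all_rcons => /andP[/= ik /IH[u [j [d [uk jd Es Ps]]]]].
have P x : permute (rcons s i) x =
    permute u (permute (descent j d) (exchange i x)).
  by rewrite -cats1 permute_cat Ps permute_cat.
rewrite taus_rcons Es.
(* The new letter is far from the descent, extends it, cancels its last letter, or slides through
   it. *)
have [ij|[ij|[ij|ij]]] : i.+1 < j \/ i.+1 = j \/ i = j \/ j < i by lia.
- exists (rcons u i), j, d; split => //.
  + by rewrite all_rcons uk andbT /=; lia.
  + by rewrite !taus_cat taus_rcons -!mulgA far_descent.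
  + move=> x; rewrite P -cats1 -catA !permute_cat; congr permute.
    rewrite /= !permute_descent /exchange.
    by repeat case: eqP; repeat case: ifP; lia.
- exists u, i, d.+1; split => //; first by lia.
  + by rewrite -ij descentS !taus_cat taus_rcons mulgA.
  + by move=> x; rewrite P -ij descentS -cats1 !permute_cat.
- case: d jd Es Ps P => [|d] jd Es Ps P; first by lia.
  exists u, j.+1, d; split => //; first by lia.
  + by rewrite ij descentS !taus_cat taus_rcons mulgA -(mulgA _ (tau j)) tauK mulg1.
  + move=> x; rewrite P ij descentS -cats1 !permute_cat /=; congr permute.
    by rewrite exchangeK.
- exists (rcons u i.-1), j, d; split => //.
  + by rewrite all_rcons uk andbT /=; lia.
  + by rewrite !taus_cat taus_rcons -!mulgA descent_slide //; lia.
  + move=> x; rewrite P -cats1 -catA !permute_cat; congr permute.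
    rewrite /= !permute_descent /exchange.
    by repeat case: eqP; repeat case: ifP; lia.
Qed.

(** Faithfulness of the presentation of the symmetric group. In the coset normal form, the point [j]
    is sent to the top; as the permutation is trivial, [j] is the top itself, the descent is empty,
    and one descends to a smaller group. *)
Lemma taus_id k s : k <= N -> all (gtn k) s -> permute s =1 id -> taus s = 1.
Proof.
elim: k s => [|k IH] s kN; first by case: s => // _ _; rewrite taus_nil.
move=> /(taus_normal_form kN)[u [j [d [uk jd -> Ps]]]] sid.
have := Ps j; rewrite sid permute_cat permute_descent ltnn eqxx jd.
rewrite (permute_fix uk) // => jk.
have d0 : d = 0 by lia.
rewrite d0 cats0 in Ps *; apply: IH => //; first by lia.
by move=> x; rewrite -Ps sid.
Qed.

Lemma eq_taus s t : all (gtn N) s -> all (gtn N) t -> permute s =1 permute t ->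
  taus s = taus t.
Proof.
move=> sN tN st; have : taus (rev t ++ s) = 1.
  apply: (@taus_id N) => //; first by rewrite all_cat all_rev tN.
  by move=> x; rewrite permute_cat st permute_rev.
rewrite taus_cat => E.
by rewrite -[LHS]mul1g -(taus_revK t) -mulgA E mulg1.
Qed.

End StrongRelations.

(** * Unordered pairs of strands and transitivity of permutations *)

Definition npair (a b : nat) : nat * nat := (minn a b, maxn a b).

Definition disjoint_pairs (p q : nat * nat) : bool :=
  [&& p.1 != q.1, p.1 != q.2, p.2 != q.1 & p.2 != q.2].

Lemma npairC a b : npair a b = npair b a.
Proof. by rewrite /npair minnC maxnC. Qed.

Lemma npair_eq a b c d :
  npair a b = npair c d -> (a = c /\ b = d) \/ (a = d /\ b = c).
Proof. by case; lia. Qed.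

Lemma disjoint_npair a b c d : disjoint_pairs (npair a b) (npair c d) =
  [&& a != c, a != d, b != c & b != d].
Proof. by rewrite /disjoint_pairs /=; lia. Qed.

Lemma disjoint_pairs_sym : symmetric disjoint_pairs.
Proof. by case=> a b [c d]; rewrite /disjoint_pairs /=; lia. Qed.

Lemma disjoint_pairs_irr : irreflexive disjoint_pairs.
Proof. by case=> a b; rewrite /disjoint_pairs eqxx. Qed.

Lemma npair_map (f : nat -> nat) a b c d :
  npair a b = npair c d -> npair (f a) (f b) = npair (f c) (f d).
Proof. by move=> /npair_eq[[-> ->]|[-> ->]] //; apply: npairC. Qed.

(** A conjugate of a transposition transposes the images of the two points, in whichever order they
    come. *)
Lemma conj_exchange (f : nat -> nat) i j k : injective f ->
    npair (f i) (f i.+1) = npair j j.+1 ->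
  f (exchange i k) = exchange j (f k).
Proof.
move=> inj ij; rewrite {1}/exchange.
case: eqP => [->|ki]; last case: eqP => [->|ki'].
- by case: (npair_eq ij) => -[-> ->]; rewrite /exchange; repeat case: eqP; lia.
- by case: (npair_eq ij) => -[-> ->]; rewrite /exchange; repeat case: eqP; lia.
- have fki : f k <> f i by move/inj.
  have fki' : f k <> f i.+1 by move/inj.
  move: (npair_eq ij); rewrite /exchange.
  by repeat case: eqP; lia.
Qed.

(** High transitivity, with positions counted down from the top one. A descent carries the head of
    [l] to the top; its inverse follows a word, given by induction, that fixes the top. *)
Lemma permute_realize k (l : seq nat) : uniq l -> all (geq k) l ->
  exists2 s, all (gtn k) s
    & forall x, x < size l -> permute s (k - x) = nth 0 l x.
Proof.
move Em: (size l) => m.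
elim: m l k Em => [|m IH] [|a l] // k; first by exists [::].
move=> /= [lm] /andP[al ul] /andP[ak lk].
case: k ak lk => [|k] ak lk.
  case: l lm al ul lk {IH} => [|b l]; last first.
    by rewrite inE /=; case: b; case: a ak.
  by move=> <- _ _ _; exists [::] => // -[|x] //= _; case: a ak.
have [d kd] : exists d, k.+1 = a + d by exists (k.+1 - a); lia.
have cd : all (gtn k.+1) (descent a d).
  by apply/allP=> x; rewrite mem_rev mem_iota /=; lia.
have ca : permute (descent a d) a = k.+1 by rewrite permute_descent ltnn eqxx.
have [|||s2 s2k Ps2] := IH (map (permute (descent a d)) l) k.
- by rewrite size_map.
- by rewrite (map_inj_uniq (@permute_inj _)).
- apply/allP=> _ /mapP[b bl ->] /=; rewrite -ltnS ltn_neqAle.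
  rewrite (permute_le cd (allP lk b bl)) andbT -ca (inj_eq (@permute_inj _)).
  by apply: contra al => /eqP <-.
exists (rev (descent a d) ++ s2).
  rewrite all_cat all_rev cd; apply: sub_all s2k => x /=; lia.
case=> [|x] /= xl; rewrite permute_cat.
  by rewrite subn0 (permute_fix s2k) // -ca permute_rev.
by rewrite subSS Ps2 // (nth_map 0) ?lm // permute_rev.
Qed.

(** * Semidirect product normal form for strong equivalence *)

Section StrongNormalForm.
Variable n : nat.
Implicit Types (i j k : nat) (s t : seq nat).
Local Open Scope group_scope.
Local Notation N := n.-1.
Local Notation tau := (@tau n).
Local Notation zeta := (@zeta n).
Local Notation taus := (@taus n).

(* The normal form applied twice shows that the stabilizer of the two topmost
   positions is generated by [tau m] and letters far from [m]. *)
Lemma zeta_top m s : N = m.+1 -> all (gtn N) s ->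
    npair (permute s m) (permute s m.+1) = npair m m.+1 ->
  zeta m * taus s = taus s * zeta m.
Proof.
move=> Nm; rewrite Nm => sm mm.
have [|u [j [d [um jd Es Ps]]]] := @taus_normal_form n m s _ sm.
  by rewrite Nm.
(* Second application, to [u]: the letters of [u'] are far from [m]. For [m = 0] the word [u] is
   empty. *)
have [u' [j' [d' [um' jd' Eu Pu]]]] : exists u' j' d',
    [/\ all (fun i => i.+1 < m) u', j' + d' = m,
        taus u = taus (u' ++ descent j' d')
      & permute u =1 permute (u' ++ descent j' d')].
  case: m Nm um {sm mm jd} => [|m] Nm um.
    by exists [::], 0, 0; split=> //; case: u um {Es Ps}.
  by have [|u' [j' [d' H]]] := @taus_normal_form n m u _ um;
    [rewrite Nm | exists u', j', d'].
have u'm : permute u' m = m.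
  elim: u' um' {Eu Pu} => //= a u' IH /andP[am /IH ->].
  by rewrite /exchange; repeat case: eqP; lia.
have uj' : permute u j' = m.
  by rewrite Pu permute_cat permute_descent ltnn eqxx jd'.
have sj : permute s j = m.+1.
  by rewrite Ps permute_cat permute_descent ltnn eqxx jd (permute_fix um).
have zu' : zeta m * taus u' = taus u' * zeta m.
  apply: commute_taus => i /(allP um') im.
  by apply: zeta_tau_far; rewrite /far; lia.
(* If the two top positions are fixed, both descents are empty. If they are exchanged, [taus s] is
   [taus u' * tau m], and virtualization handles the last factor. *)
have [[sm0 sm1]|[sm0 sm1]] := npair_eq mm.
  have jm : j = m.+1 by apply: (@permute_inj s); rewrite sj sm1.
  have d0 : d = 0 by lia.
  rewrite {}d0 {d jd} cats0 in Es Ps.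
  have j'm : j' = m by apply: (@permute_inj s); rewrite Ps uj' sm0.
  have d0 : d' = 0 by lia.
  by rewrite Es Eu d0 cats0.
have jm : j = m by apply: (@permute_inj s); rewrite sj sm0.
have d1 : d = 1%N by lia.
have j'm : j' = m.
  apply: (@permute_inj u); rewrite uj' -[LHS]sm1 Ps permute_cat.
  by congr permute; rewrite permute_descent jm d1; repeat case: ifP; lia.
have d0 : d' = 0 by lia.
rewrite Es d1 jm taus_cat Eu d0 cats0 [descent m 1]/(rev [:: m]) /= taus1.
by rewrite mulgA zu' -!mulgA zeta_tau.
Qed.

Lemma zeta_to_top m i : N = m.+1 -> i <= m ->
  exists e, [/\ all (gtn N) e, zeta i * taus e = taus e * zeta m,
    permute e m = i & permute e m.+1 = i.+1].
Proof.
move=> Nm im; have [d md] : exists d, i + d = m by exists (m - i); lia.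
elim: d i im md => [|d IH] i im md.
  exists [::]; rewrite -md addn0; split=> //.
  by rewrite taus_nil mulg1 mul1g.
have [||e [eN Ee em em1]] := IH i.+1; try lia.
exists [:: i.+1, i & e]; split=> /=.
- by rewrite eN andbT; lia.
- rewrite !taus_cons !mulgA.
  (* The mixed relation read backwards: multiply it by [tau i.+1 * tau i] on both sides. *)
  have -> : zeta i * tau i.+1 * tau i = tau i.+1 * tau i * zeta i.+1; last first.
    by rewrite -!mulgA Ee.
  have /tau_tau_zeta H : i.+1 < N by lia.
  have : tau i.+1 * tau i * (tau i * tau i.+1 * zeta i) * tau i.+1 * tau i =
    tau i.+1 * tau i * (zeta i.+1 * tau i * tau i.+1) * tau i.+1 * tau i.
    by rewrite H.
  rewrite !mulgA -(mulgA _ (tau i) (tau i)) tauK mulg1 tauK mul1g => ->.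
  rewrite -(mulgA _ (tau i.+1) (tau i.+1)) tauK mulg1.
  by rewrite -(mulgA _ (tau i) (tau i)) tauK mulg1.
- by rewrite em /exchange; repeat case: eqP; lia.
- by rewrite em1 /exchange; repeat case: eqP; lia.
Qed.

(** Conjugating both crossings to the top reduces the claim to [zeta_top], applied to
    [rev e ++ s ++ f]. *)
Lemma zeta_conj i j s : i < N -> j < N -> all (gtn N) s ->
    npair (permute s j) (permute s j.+1) = npair i i.+1 ->
  zeta i * taus s = taus s * zeta j.
Proof.
move=> iN jN sN sij; have [m Nm] : exists m, N = m.+1 by exists N.-1; lia.
have [|e [eN Ee em em1]] := @zeta_to_top m i Nm; first by lia.
have [|f [fN Ef fm fm1]] := @zeta_to_top m j Nm; first by lia.
have := @zeta_top m (rev e ++ s ++ f) Nm.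
rewrite !all_cat all_rev eN sN fN => /(_ isT).
rewrite !permute_cat fm fm1 (npair_map (permute (rev e)) sij).
rewrite -{1}em -{1}em1 !permute_rev !taus_cat => /(_ erefl) H.
have -> : zeta i = taus e * zeta m * taus (rev e).
  by rewrite -Ee -mulgA taus_revK mulg1.
have -> : zeta j = taus f * zeta m * taus (rev f).
  by rewrite -Ef -mulgA taus_revK mulg1.
rewrite -[in LHS](mulg1 (taus s)) -(taus_revK _ f).
rewrite -!mulgA (mulgA _ (taus f)) (mulgA (taus (rev e))) (mulgA (zeta m)) H.
by rewrite !mulgA taus_revK mul1g.
Qed.

(* The Coxeter generator [zeta_i tau_i] conjugated by a virtual word; it only
   depends on the pair of strands meeting at the crossing. *)
Definition cross s i : strong_monoid n :=
  taus s * zeta i * tau i * taus (rev s).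

(** The word [c] takes the positions [j, j.+1] to [i, i.+1], so [zeta_conj] carries the classical
    letter across it. *)
Lemma eq_cross s t i j : i < N -> j < N -> all (gtn N) s -> all (gtn N) t ->
    npair (permute s i) (permute s i.+1) =
    npair (permute t j) (permute t j.+1) ->
  cross s i = cross t j.
Proof.
move=> iN jN sN tN st; pose c := rev s ++ t.
have cN : all (gtn N) c by rewrite all_cat all_rev sN.
have cj : npair (permute c j) (permute c j.+1) = npair i i.+1.
  by rewrite !permute_cat -(npair_map (permute (rev s)) st) !permute_rev.
have Ets : taus t = taus s * taus c by rewrite taus_cat mulgA taus_revK mul1g.
(* An identity between virtual words, hence only a comparison of permutations. *)
have Ej : tau j * taus (rev t) = taus (rev c) * tau i * taus (rev s).
  rewrite -taus_cons -mulgA -taus_cons -taus_cat; apply: eq_taus.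
  - by rewrite /= all_rev jN.
  - by rewrite all_cat /= !all_rev cN iN.
  move=> x; rewrite permute_cat /= -(permute_revK s x).
  rewrite permute_rev (@conj_exchange _ i j); last 2 first.
  - exact: permute_inj.
  - by rewrite -(npair_map (permute (rev c)) cj) !permute_rev.
  by rewrite rev_cat revK permute_cat.
rewrite /cross Ets -!(mulgA _ (tau j)) Ej -(mulgA _ (taus c)).
rewrite -(zeta_conj (i := i) (s := c)) //.
by rewrite !mulgA -(mulgA _ (taus c)) taus_revK mulg1.
Qed.

(** One permutation [c] brings the four strands to the top four positions. Both elements are then
    conjugates by [c] of products of letters with far indices [N - 1] and [N - 3]. *)
Lemma cross_comm s t i j : i < N -> j < N -> all (gtn N) s -> all (gtn N) t ->
    disjoint_pairs (npair (permute s i) (permute s i.+1))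
                   (npair (permute t j) (permute t j.+1)) ->
  cross s i * cross t j = cross t j * cross s i.
Proof.
move=> iN jN sN tN; rewrite disjoint_npair => /and4P[n1 n2 n3 n4].
pose l := [:: permute s i.+1; permute s i; permute t j.+1; permute t j].
have ul : uniq l.
  rewrite /= !inE !negb_or !(inj_eq (@permute_inj _)).
  by rewrite n1 n2 n3 n4 !neq_ltn !ltnSn !orbT.
have lN : all (geq N) l.
  by rewrite /= !permute_le // ltnW.
(* Four distinct strands among [0, ..., N]; this makes the subtractions below exact. *)
have N3 : N >= 3.
  have /uniq_leq_size : {subset l <= iota 0 N.+1}.
    by move=> x /(allP lN); rewrite mem_iota.
  by move=> /(_ ul); rewrite size_iota.
have [c cN Pc] := permute_realize ul lN.
have := (Pc 0 isT, Pc 1%N isT, Pc 2 isT, Pc 3 isT).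
rewrite /= subn0 => -[[[P0 P1] P2] P3].
rewrite (@eq_cross s c i (N - 1)%N) ?(@eq_cross t c j (N - 3)%N) //; try lia.
- have E k : taus c * zeta k * tau k * taus (rev c) =
             taus c * (zeta k * tau k) * taus (rev c) by rewrite !mulgA.
  have F x y : taus c * x * taus (rev c) * (taus c * y * taus (rev c)) =
               taus c * (x * y) * taus (rev c).
    by rewrite !mulgA -(mulgA _ _ (taus c)) taus_rev mulg1.
  have fr : far (N - 1)%N (N - 3)%N by rewrite /far; lia.
  have fr' : far (N - 3)%N (N - 1)%N by rewrite /far; lia.
  rewrite /cross !E !F; congr (_ * _ * _); rewrite !mulgA.
  rewrite -(mulgA (zeta _)) -(zeta_tau_far _ fr') mulgA zeta_far //.
  rewrite -!mulgA (tau_far _ fr) (mulgA (zeta (N - 1)%N)).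
  by rewrite (zeta_tau_far _ fr) !mulgA.
- have -> : (N - 3)%N.+1 = N - 2 by lia.
  by rewrite P3 P2.
- have -> : (N - 1)%N.+1 = N by lia.
  by rewrite P1 P0.
Qed.

(* Pairs that are not realized by two strands get the junk value [1]. *)
Definition pair_elt (p : nat * nat) : strong_monoid n :=
  if pselect (exists si : seq nat * nat, [/\ si.2 < N, all (gtn N) si.1 &
      p = npair (permute si.1 si.2) (permute si.1 si.2.+1)]) is left ex
  then let si := projT1 (cid ex) in cross si.1 si.2 else 1.

Lemma pair_elt_cases p : pair_elt p = 1 \/ exists s i,
  [/\ i < N, all (gtn N) s, p = npair (permute s i) (permute s i.+1)
    & pair_elt p = cross s i].
Proof.
rewrite /pair_elt; case: pselect => [ex|_]; last by left.
by right; case: (cid ex) => -[s i] /= [iN sN ps]; exists s, i.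
Qed.

Lemma pair_eltE s i : i < N -> all (gtn N) s ->
  pair_elt (npair (permute s i) (permute s i.+1)) = cross s i.
Proof.
move=> iN sN; rewrite /pair_elt.
case: pselect => [ex|[]]; last by exists (s, i).
by case: (cid ex) => -[t j] /= [jN tN st]; apply/esym/eq_cross.
Qed.

Lemma pair_elt_comm p q : disjoint_pairs p q ->
  pair_elt p * pair_elt q = pair_elt q * pair_elt p.
Proof.
have [->|[s [i [iN sN ps ->]]]] := pair_elt_cases p.
  by rewrite mulg1 mul1g.
have [->|[t [j [jN tN qt ->]]]] := pair_elt_cases q.
  by rewrite mulg1 mul1g.
by rewrite ps qt; apply: cross_comm.
Qed.

(* Strand pairs of the classical crossings, when the strand in position [k] at
   the top of [w] is [g k]. *)
Fixpoint pairs (g : nat -> nat) (w : braid_word n) : seq (nat * nat) :=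
  match w with
  | [::] => [::]
  | Zeta i :: w' => npair (g i) (g i.+1) :: pairs (g \o exchange i) w'
  | Tau i :: w' => pairs (g \o exchange i) w'
  end.

Lemma eq_pairs (g h : nat -> nat) : g =1 h -> pairs g =1 pairs h.
Proof.
move=> gh w; elim: w g h gh => //= -[] i w IH g h gh.
  by rewrite !gh; congr cons; apply: IH => k /=.
by apply: IH => k /=.
Qed.

Definition indices (w : braid_word n) : seq nat :=
  [seq val (letter_index a) | a <- w].

Lemma indices_lt w : all (gtn N) (indices w).
Proof. by apply/allP=> _ /mapP[a _ ->] /=. Qed.

Lemma strand_atE w : strand_at w =1 permute (indices w).
Proof. by move=> k; rewrite /strand_at /permute foldr_map. Qed.

(** Each [zeta i] is written as [zeta i * tau i * tau i]: the first two factors, conjugated by the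
    prefix [t], give a [cross], and the last one joins the prefix. The induction needs an arbitrary
    [t]. *)
Lemma strong_normal_form t w : all (gtn N) t ->
  taus t * strong_class w =
  \prod_(p <- pairs (permute t) w) pair_elt p * taus (t ++ indices w).
Proof.
elim: w t => [|a w IH] t tN /=.
  by rewrite big_nil mul1g cats0 -[RHS]mulg1.
rewrite -cat1s strong_class_cat.
have aN : all (gtn N) (rcons t (letter_index a)).
  by rewrite all_rcons /= ltn_ord.
have Ep : permute (rcons t (letter_index a)) =1
          permute t \o exchange (letter_index a).
  by move=> k; rewrite -cats1 permute_cat.
have := IH _ aN; rewrite (eq_pairs Ep) cat_rcons.
case: a {aN Ep} => i /= IHi; rewrite ?big_cons -?tau_ord -?zeta_ord.
  rewrite pair_eltE // -mulgA -IHi taus_rcons /cross !mulgA.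
  rewrite -(mulgA _ (taus (rev t)) (taus t)) taus_rev mulg1.
  by rewrite -(mulgA _ (tau i) (tau i)) tauK mulg1.
by rewrite -IHi taus_rcons mulgA.
Qed.

Lemma strongly_equivalent_pairs u v :
    word_equiv (comm_rel disjoint_pairs) (pairs id u) (pairs id v) ->
    strand_at u =1 strand_at v ->
  strongly_equivalent u v.
Proof.
move=> uv suv; apply/strong_classP.
have E w : strong_class w =
    \prod_(p <- pairs id w) pair_elt p * taus (indices w).
  rewrite -[indices w]cat0s -(@eq_pairs (permute [::]) id) //.
  by rewrite -strong_normal_form // taus_nil mul1g.
rewrite !E; congr (_ * _); last first.
  by apply: eq_taus => [||k]; rewrite ?indices_lt // -!strand_atE.
move: uv; apply: (word_equiv_min (E := fun l m =>
  \prod_(p <- l) pair_elt p = \prod_(p <- m) pair_elt p)) => //.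
  by move=> l m r -> ->.
move=> A _ _ C [p q pq]; rewrite !big_cat; congr (_ * (_ * _)).
by rewrite !big_cons !big_nil /= !mulg1 pair_elt_comm.
Qed.

End StrongNormalForm.

(** * Bigon reductions *)

Section Bigons.
Variable n : nat.
Implicit Types (u v w A C M : braid_word n) (g h : nat -> nat).

Lemma strand_at_cat u v k : strand_at (u ++ v) k = strand_at u (strand_at v k).
Proof. by rewrite /strand_at foldr_cat. Qed.

Lemma strand_at_cons (a : letter n) w k :
  strand_at (a :: w) k = exchange (letter_index a) (strand_at w k).
Proof. by []. Qed.

Lemma strand_at_inj w : injective (strand_at w).
Proof. by move=> j k; rewrite !strand_atE => /permute_inj. Qed.

Lemma pairs_cat g u v :
  pairs g (u ++ v) = pairs g u ++ pairs (g \o strand_at u) v.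
Proof.
by elim: u g => //= -[] i u IH g; rewrite IH.
Qed.

(** Only far commutation of two classical letters and the classical square alter the sequence of
    pairs; injectivity of [g] makes the pairs of far letters disjoint. *)
Lemma F_rel_pairs g p q : injective g -> F_rel p q ->
  word_equiv (coxeter_rel disjoint_pairs) (@pairs n g p) (pairs g q).
Proof.
move=> inj pq.
have exf i j : far i j -> exchange i j = j.
  by rewrite /far /exchange; repeat case: eqP; lia.
have exf1 i j : far i j -> exchange i j.+1 = j.+1.
  by rewrite /far /exchange; repeat case: eqP; lia.
case: pq => [_ _ [i|i|i j ij|i j ij|i j ij|i j ij|i j ij]|i] /=;
  try exact: rst_refl.
- by rewrite exchange_l exchange_r npairC; apply: rst_refl.
- have ji : far j i by rewrite /far orbC.
  rewrite !exf1 ?exf //.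
  apply/word_equiv_base/CoxeterSwap; rewrite disjoint_npair !(inj_eq inj).
  by move: ij; rewrite /far; lia.
- have ji : far j i by rewrite /far orbC.
  by rewrite !exf1 ?exf //; apply: rst_refl.
- have -> : exchange i (exchange j i) = j.
    by rewrite ij /exchange; repeat case: eqP; lia.
  have -> : exchange i (exchange j i.+1) = j.+1.
    by rewrite ij /exchange; repeat case: eqP; lia.
  exact: rst_refl.
- by rewrite exchange_l exchange_r npairC; apply/word_equiv_base/CoxeterSquare.
Qed.

Lemma F_rel_strand p q : @F_rel n p q -> strand_at p =1 strand_at q.
Proof.
case=> [_ _ [i|i|i j ij|i j ij|i j ij|i j ij|i j ij]|i] k //=;
  rewrite /strand_at /= ?exchangeK //;
  move: ij; rewrite /exchange ?/far => ij; repeat case: eqP; lia.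
Qed.

Lemma F_equiv_invariants u v : word_equiv (@F_rel n) u v ->
  word_equiv (coxeter_rel disjoint_pairs) (pairs id u) (pairs id v) /\
  strand_at u =1 strand_at v.
Proof.
move: u v; apply: word_equiv_min.
- by move=> u; split=> //; apply: rst_refl.
- by move=> u v [uv suv]; split=> [|k]; [apply: rst_sym | rewrite suv].
- move=> u v w [uv suv] [vw svw].
  by split=> [|k]; [apply: rst_trans vw | rewrite suv].
move=> A p q C pq; have sE := F_rel_strand pq; split=> [|k]; last first.
  by rewrite !strand_at_cat sE.
rewrite !pairs_cat; apply: word_equiv_cat; first exact: rst_refl.
apply: word_equiv_cat; first exact/F_rel_pairs/pq/strand_at_inj.
rewrite (@eq_pairs _ _ (id \o strand_at A \o strand_at q)).
  exact: rst_refl.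
by move=> k /=; rewrite sE.
Qed.

(** A bigon phrased as a cancellation in the sequence of pairs. Strands inside [M] are named by [h],
    which accounts for the upper crossing. *)
Definition bigon_at A (i : 'I_n.-1) M (j : 'I_n.-1) :=
  let h := strand_at A \o exchange i in
  let p := npair (h i) (h i.+1) in
  npair (h (strand_at M j)) (h (strand_at M j.+1)) = p /\
  all (disjoint_pairs p) (pairs h M).

Lemma pull_pairs g p w r : pull disjoint_pairs p (pairs g w) = Some r ->
  exists M (j : 'I_n.-1) C, [/\ w = M ++ Zeta j :: C,
    npair (g (strand_at M j)) (g (strand_at M j.+1)) = p
    & all (disjoint_pairs p) (pairs g M)].
Proof.
elim: w g r => //= -[] i w IH g r /=.
  have [<- _|_] := eqVneq; first by exists [::], i, w.
  case: ifP => // pi; case E: pull => [s|] // _.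
  have [M [j [C [-> Ep dM]]]] := IH _ _ E.
  by exists (Zeta i :: M), j, C; rewrite /= pi.
by move/IH=> [M [j [C [-> Ep dM]]]]; exists (Tau i :: M), j, C.
Qed.

Lemma not_reduced_bigon w : ~~ reduced disjoint_pairs (pairs id w) ->
  exists A i M j C, w = A ++ Zeta i :: M ++ Zeta j :: C /\ bigon_at A i M j.
Proof.
(* Strands are named from the top, so the induction on the suffix carries the prefix [A] along. *)
suff gen A : ~~ reduced disjoint_pairs (pairs (strand_at A) w) ->
    exists A' i M j C, A ++ w = A' ++ Zeta i :: M ++ Zeta j :: C /\
      bigon_at A' i M j.
  by rewrite (@eq_pairs _ id (strand_at (Nil (letter n)))) //; apply: gen.
elim: w A => // a w IH A; rewrite -cat_rcons.
have IHa : ~~ reduced disjoint_pairs (pairs (strand_at (rcons A a)) w) ->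
    exists A' i M j C, rcons A a ++ w = A' ++ Zeta i :: M ++ Zeta j :: C /\
      bigon_at A' i M j by move/IH.
have Ea : strand_at (rcons A a) =1 strand_at A \o exchange (letter_index a).
  by move=> k; rewrite -cats1 strand_at_cat.
rewrite (eq_pairs Ea) in IHa.
case: a IHa {Ea} => i /= IHa //.
rewrite negb_and; case E: pull => [r|] //= _.
have [M [j [C [-> Ep dM]]]] := pull_pairs E.
exists A, i, M, j, C; rewrite cat_rcons; split=> //.
have Ei : npair (strand_at A (exchange i i)) (strand_at A (exchange i i.+1)) =
          npair (strand_at A i) (strand_at A i.+1).
  by rewrite exchange_l exchange_r npairC.
by rewrite /bigon_at /= Ei.
Qed.

Lemma classical_at A (a : letter n) C :
  classical (A ++ a :: C) (size A) = if a is Zeta _ then true else false.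
Proof. by rewrite /classical onth_cat ltnn subnn. Qed.

Lemma on_strand_at A (a : letter n) C s : on_strand (A ++ a :: C) (size A) s =
  (s \in [:: strand_at A (letter_index a); strand_at A (letter_index a).+1]).
Proof.
by rewrite /on_strand onth_cat ltnn subnn take_size_cat.
Qed.

Lemma classical_split w k : classical w k ->
  exists i, w = take k w ++ Zeta i :: drop k.+1 w.
Proof.
rewrite /classical; elim: w k => [|a w IH] [|k] //=.
  by rewrite drop0; case: a => // i _; exists i.
by case/IH=> i Ew; exists i; rewrite {1}Ew.
Qed.

Lemma bigon_at_bigon A i M j C : bigon_at A i M j ->
  bigon (A ++ Zeta i :: M ++ Zeta j :: C) (size A) (size (A ++ Zeta i :: M)).
Proof.
rewrite /bigon_at /= => -[Ep dM].
pose h := strand_at A \o exchange i.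
have Ew : A ++ Zeta i :: M ++ Zeta j :: C = (A ++ Zeta i :: M) ++ Zeta j :: C.
  by rewrite -catA.
split.
- by rewrite size_cat /= addnS ltnS leq_addr.
- by rewrite classical_at.
- by rewrite Ew classical_at.
have hi : h i = strand_at A i.+1 by rewrite /h /= exchange_l.
have hi1 : h i.+1 = strand_at A i by rewrite /h /= exchange_r.
exists (h i), (h i.+1); split.
- by rewrite hi hi1 (inj_eq (@strand_at_inj _)); lia.
- by rewrite !on_strand_at !inE hi hi1 !eqxx !orbT.
- rewrite Ew !on_strand_at !inE !strand_at_cat /=.
  by case: (npair_eq Ep) => -[-> ->]; rewrite !eqxx !orbT.
move=> y /andP[]; rewrite size_cat /= => Ay yM cy.
(* The successor accounts for the upper crossing between [A] and [M]. *)
have {Ay yM} [k kM yE] : exists2 k, k < size M & y = size A + k.+1.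
  by exists (y - (size A).+1); lia.
have cM : classical M k.
  move: cy; rewrite yE /classical onth_cat ltnNge leq_addr addKn /=.
  by rewrite onth_cat kM.
have [l Ml] := classical_split cM.
have sk : size (A ++ Zeta i :: take k M) = y.
  by rewrite size_cat /= size_take kM yE.
have -> : A ++ Zeta i :: M ++ Zeta j :: C =
    (A ++ Zeta i :: take k M) ++ Zeta l :: (drop k.+1 M ++ Zeta j :: C).
  by rewrite {1}Ml -!catA.
rewrite -sk !on_strand_at !strand_at_cat /=.
rewrite Ml pairs_cat all_cat /= in dM; case/and3P: dM => _ dl _.
by move: dl; rewrite disjoint_npair !inE !negb_or => /and4P[-> -> -> ->].
Qed.

Definition swap_values (a b k : nat) : nat :=
  if k == a then b else if k == b then a else k.

Lemma eq_npair_swap a b c d k : npair a b = npair c d ->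
  swap_values a b k = swap_values c d k.
Proof.
move=> /npair_eq[[-> ->]|[-> ->]] //.
by rewrite /swap_values; repeat case: eqP; lia.
Qed.

Lemma exchange_swap g i k : injective g ->
  g (exchange i k) = swap_values (g i) (g i.+1) (g k).
Proof.
move=> inj; rewrite /swap_values !(inj_eq inj) /exchange.
by repeat case: eqP.
Qed.

(* Between the two crossings of a bigon, deleting the upper one only exchanges
   the names of its two strands, which meet no classical crossing there. *)
Lemma pairs_swap g a b w : all (disjoint_pairs (npair a b)) (pairs g w) ->
  pairs (swap_values a b \o g) w = pairs g w.
Proof.
have E h i : pairs ((swap_values a b \o h) \o exchange i) =1
             pairs (swap_values a b \o (h \o exchange i)) by exact: eq_pairs.
elim: w g => //= -[] i w IH g /=; last by move=> /IH; rewrite E.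
case/andP=> di /IH ew; rewrite E ew; congr (_ :: _).
move: di; rewrite disjoint_npair /swap_values => /and4P[].
by rewrite !(eq_sym _ (g _)) => /negPf -> /negPf -> /negPf -> /negPf ->.
Qed.

(** The two crossings induce the same transposition of strand names, so names in [C] are unaffected
    by the deletion. The pairs of [M] are unchanged by [pairs_swap], and the two equal pairs around
    them cancel by [coxeter_delete]. *)
Lemma delete_bigon A i M j C : bigon_at A i M j ->
  word_equiv (coxeter_rel disjoint_pairs)
    (pairs id (A ++ Zeta i :: M ++ Zeta j :: C)) (pairs id (A ++ M ++ C)) /\
  strand_at (A ++ Zeta i :: M ++ Zeta j :: C) =1 strand_at (A ++ M ++ C).
Proof.
rewrite /bigon_at; set h := _ \o _; set p := npair (h i) _ => -[Ep dM].
have hinj : injective h.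
  by move=> x y /strand_at_inj /(can_inj (exchangeK i)).
have hMinj : injective (h \o strand_at M) by move=> x y /hinj /strand_at_inj.
have hA k : strand_at A k = swap_values (h i) (h i.+1) (h k).
  by rewrite -exchange_swap // /h /= exchangeK.
have hMj k : h (strand_at M (exchange j k)) =
             swap_values (h i) (h i.+1) (h (strand_at M k)).
  by rewrite -(eq_npair_swap _ Ep); apply: (exchange_swap j k hMinj).
have Ei : npair (strand_at A i) (strand_at A i.+1) = p.
  by rewrite npairC /p /h /= exchange_l exchange_r.
split; last first.
  move=> k; rewrite !strand_at_cat strand_at_cons strand_at_cat.
  by rewrite strand_at_cons [RHS]hA; apply: hMj.
rewrite !pairs_cat /= pairs_cat /= -/h Ei Ep -/p.
rewrite (@eq_pairs _ (id \o strand_at A) (swap_values (h i) (h i.+1) \o h)) //.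
rewrite pairs_swap //.
rewrite (@eq_pairs _ (_ \o exchange j) ((id \o strand_at A) \o strand_at M)).
  rewrite -cat_cons -cat_rcons.
  apply: word_equiv_cat; first exact: rst_refl.
  apply: word_equiv_cat; last exact: rst_refl.
  exact: coxeter_delete.
by move=> k /=; rewrite hA -hMj.
Qed.

(** Bigons are deleted until none is left; each deletion shortens the word. *)
Lemma reduce_word w : exists s, [/\ subseq s w,
  word_equiv (coxeter_rel disjoint_pairs) (pairs id w) (pairs id s),
  strand_at w =1 strand_at s & reduced disjoint_pairs (pairs id s)].
Proof.
have [m] := ubnP (size w); elim: m w => // m IH w; rewrite ltnS => wm.
case rw: (reduced disjoint_pairs (pairs id w)).
  by exists w; split=> //; apply: rst_refl.
have [A [i [M [j [C [Ew bij]]]]]] := not_reduced_bigon (negbT rw).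
have [pw sw] := delete_bigon C bij.
have sub : subseq (A ++ M ++ C) w.
  rewrite Ew; apply: cat_subseq => //.
  by apply: (subseq_trans _ (subseq_cons _ _)); apply/cat_subseq/subseq_cons.
have [|s [sub' ps ss rs]] := IH (A ++ M ++ C).
  by apply: leq_trans wm; rewrite Ew !size_cat /= !size_cat /=; lia.
exists s; rewrite Ew in sub *; split=> //.
- exact: subseq_trans sub.
- exact: rst_trans ps.
- by move=> k; rewrite sw.
Qed.

End Bigons.

(** * Deletion of even crossings *)

(** Signs can be forgotten because every generator is an involution: a formal cancellation becomes
    one of the squares. *)
Lemma braid_ofP n (u v : braid_word n) :
  braid_of u = braid_of v <-> word_equiv (@FB_rel n) u v.
Proof.
split=> [/signed_classP uv|uv]; last first.
  apply/signed_classP; move: u v uv.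
  apply: (word_equiv_min (E := fun u v =>
    group_equiv (@FB_rel n) (positive u) (positive v))).
  - by move=> u; apply: rst_refl.
  - by move=> u v; apply: rst_sym.
  - by move=> u v w; apply: rst_trans.
  move=> A p q C pq; rewrite /positive !map_cat.
  exact/word_equiv_rel/GroupRelation.
have posK w : map snd (positive w) = w :> braid_word n.
  by rewrite -map_comp map_id.
rewrite -(posK u) -(posK v).
apply: (word_equiv_min (E := fun a b =>
  word_equiv (@FB_rel n) (map snd a) (map snd b))) uv.
- by move=> a; apply: rst_refl.
- by move=> a b; apply: rst_sym.
- by move=> a b c; apply: rst_trans.
move=> A _ _ C [b x|p q pq]; rewrite !map_cat ?posK;
  apply: word_equiv_rel => //.
by apply: FBF; case: x => i; [apply: ZetaZeta | apply/FStrong/TauTau].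
Qed.

Fixpoint keep (X : Type) (b : nat -> bool) (w : seq X) : seq X :=
  if w is a :: w' then
    if b 0 then a :: keep (b \o succn) w' else keep (b \o succn) w'
  else [::].

Lemma keep_subseq (X : eqType) b (w : seq X) : subseq (keep b w) w.
Proof.
elim: w b => //= a w IH b; case: (b 0); first by rewrite eqxx.
exact: subseq_trans (IH _) (subseq_cons _ _).
Qed.

Lemma eq_keep (X : Type) b c (w : seq X) :
  (forall k, k < size w -> b k = c k) -> keep b w = keep c w.
Proof.
elim: w b c => //= a w IH b c bc; rewrite bc //.
by rewrite (IH _ (c \o succn)) // => k kw; apply: bc.
Qed.

Lemma keep_true (X : Type) (b : pred nat) (w : seq X) :
  (forall k, k < size w -> b k) -> keep b w = w.
Proof.
elim: w b => //= a w IH b bt; rewrite bt // IH // => k kw.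
exact: bt.
Qed.

Lemma keep_cat (X : Type) b (u v : seq X) :
  keep b (u ++ v) = keep b u ++ keep (fun k => b (size u + k)) v.
Proof.
elim: u b => [|a u IH] b /=; first exact: eq_keep.
by rewrite IH; case: (b 0).
Qed.

Section OddPart.
Variables (n : nat) (B : set (free_braid n)).
Variable par : braid_word n -> nat -> 'Z_2.
Hypothesis Hpar : parity B par.
Implicit Types u v w A C p q : braid_word n.

(** The implication keeps every virtual letter. *)
Definition odd_part w : braid_word n :=
  keep (fun k => classical w k ==> is_odd par w k) w.

Lemma classical_catl u v k : k < size u -> classical (u ++ v) k = classical u k.
Proof. by rewrite /classical onth_cat => ->. Qed.

Lemma classical_catr u v k : classical (u ++ v) (size u + k) = classical v k.
Proof. by rewrite /classical onth_cat ltnNge leq_addr addKn. Qed.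

Lemma odd_part_cat A p C : odd_part (A ++ p ++ C) =
  keep (fun k => classical A k ==> is_odd par (A ++ p ++ C) k) A ++
  keep (fun k => classical p k ==> is_odd par (A ++ p ++ C) (size A + k)) p ++
  keep (fun k => classical C k ==>
                 is_odd par (A ++ p ++ C) (size A + size p + k)) C.
Proof.
rewrite /odd_part keep_cat keep_cat; congr (_ ++ (_ ++ _));
  apply: eq_keep => k kl.
- by rewrite classical_catl.
- by rewrite classical_catr classical_catl.
- by rewrite classical_catr classical_catr addnA.
Qed.

(** Clause 1 of parity makes the kept parts of [A] and of [C] agree on both sides; the other clauses
    match the kept letters of [p] and [q]. *)
Lemma odd_part_move A p q C : FB_rel p q -> B (braid_of (A ++ p ++ C)) ->
  word_equiv (@F_rel n) (odd_part (A ++ p ++ C)) (odd_part (A ++ q ++ C)).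
Proof.
move=> pq Bu; rewrite !odd_part_cat.
have -> : keep (fun k => classical A k ==> is_odd par (A ++ p ++ C) k) A =
          keep (fun k => classical A k ==> is_odd par (A ++ q ++ C) k) A.
  apply: eq_keep => k _; case cA: (classical A k) => //=.
  by rewrite /is_odd (parity_above Hpar pq Bu cA).
have -> : keep (fun k => classical C k ==>
      is_odd par (A ++ p ++ C) (size A + size p + k)) C =
    keep (fun k => classical C k ==>
      is_odd par (A ++ q ++ C) (size A + size q + k)) C.
  apply: eq_keep => k _; case cC: (classical C k) => //=.
  by rewrite /is_odd (parity_below Hpar pq Bu cC).
apply: word_equiv_cat; first exact: rst_refl.
apply: word_equiv_cat; last exact: rst_refl.
have base r s : @F_rel n r s -> word_equiv (@F_rel n) r s.
  exact: word_equiv_base.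
case: pq Bu => [_ _ [_ _ [i|i|i j ij|i j ij|i j ij|i j ij|i j ij]|i]|i j ij] Bu;
  rewrite /= /classical /= ?addn0.
- exact/base/FStrong/TauTau.
- rewrite /is_odd (parity_virtualization Hpar Bu); case: eqP => _ /=.
    exact/base/FStrong/Virtualization.
  exact: rst_refl.
- have [E1 E2] := parity_far_zeta Hpar ij Bu.
  rewrite /is_odd E1 E2; case: eqP => _; case: eqP => _ /=; try exact: rst_refl.
  exact/base/FStrong/FarZetaZeta.
- rewrite /is_odd (parity_far_tau Hpar ij Bu); case: eqP => _ /=.
    exact/base/FStrong/FarZetaTau.
  exact: rst_refl.
- exact/base/FStrong/FarTauTau.
- exact/base/FStrong/TauBraid.
- rewrite /is_odd (parity_mixed Hpar ij Bu); case: eqP => _ /=.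
    exact/base/FStrong/TauTauZeta.
  exact: rst_refl.
- rewrite /is_odd -(parity_zeta2 Hpar Bu); case: eqP => _ /=.
    exact/base/ZetaZeta.
  exact: rst_refl.
(* An even number of the three letters survives, so none or two. If the middle one survives, both
   sides are the same word; if only the outer two do, each side is a square. *)
have [ev E1 E2 E3] := parity_zeta3 Hpar ij Bu.
move: ev; rewrite /is_odd -E1 -E2 -E3.
case: eqP => _; case: eqP => _; case: eqP => _ //= _; try exact: rst_refl.
by apply: (@rst_trans _ _ _ [::]); [|apply: rst_sym]; apply/base/ZetaZeta.
Qed.

Lemma odd_part_equiv u v : word_equiv (@FB_rel n) u v -> B (braid_of u) ->
  word_equiv (@F_rel n) (odd_part u) (odd_part v).
Proof.
have BE x y : word_equiv (@FB_rel n) x y -> B (braid_of x) = B (braid_of y).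
  by move=> /braid_ofP ->.
(* The equivalence is carried along so that membership in [B] passes to intermediate words. *)
move=> uv; suff [] : word_equiv (@FB_rel n) u v /\
  (B (braid_of u) -> word_equiv (@F_rel n) (odd_part u) (odd_part v)) by [].
move: u v uv; apply: word_equiv_min.
- by move=> u; split=> [|_]; apply: rst_refl.
- move=> u v [uv Huv]; split; first exact: rst_sym.
  by rewrite -(BE _ _ uv) => /Huv; apply: rst_sym.
- move=> u v w [uv Huv] [vw Hvw]; split; first exact: rst_trans vw.
  move=> Bu; apply: rst_trans (Huv Bu) (Hvw _).
  by rewrite -(BE _ _ uv).
- move=> A p q C pq; split=> [|Bu]; first exact: word_equiv_rel.
  exact: odd_part_move.
Qed.

End OddPart.

Theorem theorem3 (n : nat) (B : set (free_braid n))
    (par : braid_word n -> nat -> 'Z_2) (Hpar : parity B par)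
    (beta : braid_word n) (HB : B (braid_of beta))
    (Hodd : forall k : nat, classical beta k -> is_odd par beta k)
    (Hirr : ~ exists w : braid_word n, bigon_reduction beta w)
    (beta' : braid_word n) (Hother : beta' <> beta)
    (Heq : braid_of beta' = braid_of beta) :
  exists s : braid_word n, subseq s beta' /\ strongly_equivalent s beta.
Proof.
have odd_beta : odd_part par beta = beta.
  by apply: keep_true => k _; apply/implyP/Hodd.
(* A cancellation in the sequence of pairs would give a bigon of [beta]. *)
have red_beta : reduced disjoint_pairs (pairs id beta).
  apply: contra_notT Hirr => nred.
  have [A [i [M [j [C [E bij]]]]]] := not_reduced_bigon nred.
  exists (delete_at (size A)
    (delete_at (size (A ++ Zeta i :: M)) beta)).
  exists (size A), (size (A ++ Zeta i :: M)); split=> //.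
  by rewrite E; apply: bigon_at_bigon.
have /(odd_part_equiv Hpar) := iffLR (braid_ofP beta' beta) Heq.
rewrite odd_beta Heq => /(_ HB) /F_equiv_invariants[pE sE].
have [s [sub ps ss rs]] := reduce_word (odd_part par beta').
exists s; split; first exact: subseq_trans sub (keep_subseq _ _).
apply: strongly_equivalent_pairs; last by move=> k; rewrite -ss.
(* Both sequences of pairs are reduced and represent the same Coxeter element, so only commutations
   separate them. *)
apply: (reduced_coxeter disjoint_pairs_sym disjoint_pairs_irr) => //.
exact: rst_trans (rst_sym _ _ _ _ ps) pE.
Qed.
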